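(* Let $(V_1,V_2)$ be a pure pair of commuting isometries on a Hilbert space $\mathcal{H}$, and let $(M_{\Phi_1},M_{\Phi_2})$ be the BCL representation of $(V_1,V_2)$. Then, for all $z\in\mathbb{D}$, $$\Phi_1(z) = V_1|_{\mathcal{W}_2}\oplus V_2^*|_{V_2\mathcal{W}_1}\,z,\qquad \Phi_2(z) = V_2|_{\mathcal{W}_1}\oplus V_1^*|_{V_1\mathcal{W}_2}\,z.$$ That is, for all $\eta_1\in\mathcal{W}_1$, $\eta_2\in\mathcal{W}_2$ and $z\in\mathbb{D}$, $\Phi_1(z)(V_2\eta_1\oplus\eta_2) = V_1\eta_2 + z\,\eta_1$ and $\Phi_2(z)(\eta_1\oplus V_1\eta_2) = V_2\eta_1 + z\,\eta_2$.
   Context: $\mathbb{D}$ is the open unit disc. An isometry is pure (a shift) if the powers of its adjoint tend to $0$ in the strong operator topology. For commuting isometries $(V_1,V_2)$ on $\mathcal{H}$ put $V=V_1V_2$, $\mathcal{W}=\mathcal{H}\ominus V\mathcal{H}$, $\mathcal{W}_j=\mathcal{H}\ominus V_j\mathcal{H}$ ($j=1,2$). One has the orthogonal decompositions $\mathcal{W}=\mathcal{W}_1\oplus V_1\mathcal{W}_2 = V_2\mathcal{W}_1\oplus\mathcal{W}_2$. The pair $(V_1,V_2)$ is called pure if $V$ is a pure isometry. For a Hilbert space $\mathcal{E}$, $H^2_{\mathcal{E}}(\mathbb{D})$ is the Hilbert space of $\mathcal{E}$-valued analytic functions on $\mathbb{D}$ with square-summable Taylor coefficients, $H^\infty_{\mathcal{B}(\mathcal{E})}(\mathbb{D})$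 is the space of bounded $\mathcal{B}(\mathcal{E})$-valued holomorphic functions on $\mathbb{D}$, and $M_\Theta f = \Theta f$ for $\Theta\in H^\infty_{\mathcal{B}(\mathcal{E})}(\mathbb{D})$, $f\in H^2_{\mathcal{E}}(\mathbb{D})$. For the pure isometry $V$, $\Pi_V:\mathcal{H}\to H^2_{\mathcal{W}}(\mathbb{D})$ is the Wold-von Neumann unitary determined by $\Pi_V(V^m\eta)=z^m\eta$ ($m\ge0$, $\eta\in\mathcal{W}$). The BCL (Berger-Coburn-Lebow) representation, or BCL pair, of a pure pair $(V_1,V_2)$ is the pair $(M_{\Phi_1},M_{\Phi_2})$ on $H^2_{\mathcal{W}}(\mathbb{D})$, where $\Phi_1,\Phi_2\in H^\infty_{\mathcal{B}(\mathcal{W})}(\mathbb{D})$ are the (unique) multipliers with $\Pi_VV_i = M_{\Phi_i}\Pi_V$ for $i=1,2$; they exist because $V_i$ commutes with $V$. *)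

(* Defs.v *)
From HB Require Import structures.
From mathcomp Require Import all_boot all_order all_algebra sesquilinear.
From mathcomp Require Import all_classical all_reals all_analysis.
From mathcomp Require Import complex ring lra.
Set Implicit Arguments.
Unset Strict Implicit.
Unset Printing Implicit Defensive.
Import Order.TTheory GRing.Theory Num.Theory.
Import numFieldNormedType.Exports.
Local Open Scope classical_set_scope.
Local Open Scope ring_scope.

(* Complex Hilbert spaces; the inner product is linear in its first argument. *)
HB.mixin Record NormedModule_isPreHilbert (R : realType) V
    & NormedModule R[i] V := {
  hdot : {dot V for (@Num.conj R[i])};
  hdotE : forall x : V, hdot x x = `|x| ^+ 2
}.

#[short(type="hilbertType")]
HB.structure Definition Hilbert (R : realType) :=
  {V of CompleteNormedModule R[i] V & NormedModule_isPreHilbert R V}.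

Notation "''[' u , v ]" := (hdot u%R v%R) : ring_scope.

Section HilbertTheory.
Variables (R : realType) (H : hilbertType R).
Implicit Types (x y z k : H).

Lemma hdotC x y : '[x, y] = ('[y, x])^*.
Proof. by rewrite hermC mul1r. Qed.

Lemma hdot_proj x y : y != 0 ->
  `|x - ('[x, y] / '[y, y]) *: y| ^+ 2 = `|x| ^+ 2 - `|'[x, y]| ^+ 2 / `|y| ^+ 2.
Proof.
move=> y0; have yy : 0 < '[y, y] by rewrite dnorm_gt0.
have yJ : ('[y, y])^* = '[y, y] by rewrite -hdotC.
rewrite -!hdotE dnormB dnormZ linearZr_LR/= rmorphM/= rmorphV ?unitfE ?gt_eqF//=.
rewrite normrM normfV exprMn (gtr0_norm yy) yJ normCK.
have := gt_eqF yy; set a := '[y, y] => a0.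
rewrite !rmorphM/= rmorphV ?unitfE ?a0//= yJ conjCK -/a.
by field; rewrite a0.
Qed.

Lemma hdot_CauchySchwarz x y : `|'[x, y]| <= `|x| * `|y|.
Proof.
have [->|y0] := eqVneq y 0; first by rewrite linear0r !normr0 mulr0.
rewrite -(@ler_pXn2r _ 2) ?nnegrE ?mulr_ge0// exprMn.
by rewrite -ler_pdivrMr ?exprn_gt0 ?normr_gt0// -subr_ge0 -hdot_proj// exprn_ge0.
Qed.

Lemma hdot_parallelogram x y :
  `|x - y| ^+ 2 = 2 * `|x| ^+ 2 + 2 * `|y| ^+ 2 - `|x + y| ^+ 2.
Proof. by rewrite -!hdotE dnormB dnormD; ring. Qed.

Lemma small_eq0 (a K : R[i]) : 0 <= a -> 0 <= K ->
  (forall e, 0 < e -> a <= e * K) -> a = 0.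
Proof.
move=> a0 K0 ae; apply/eqP; rewrite eq_le a0 andbT.
case/orP: (real_leVge (ger0_real a0) (real0 _)) => //; rewrite le0r => /orP[/eqP->//|a1].
have K1 : 0 < K + 1 by rewrite ltr_wpDl.
have := ae _ (divr_gt0 a1 K1).
by rewrite mulrAC ler_pdivlMr// mulrDr mulr1 gerDl => ->.
Qed.

Lemma Riesz_representation (phi : {scalar H}) (M : R[i]) :
  (forall x, `|phi x| <= M * `|x|) -> exists z, forall x, phi x = '[x, z].
Proof.
move=> phiM.
have [phi0|/existsNP[x0 /eqP px0]] := pselect (forall x, phi x = 0).
  by exists 0 => x; rewrite phi0 linear0r.
pose S := [set x | phi x = 1].
have S0 : S ((phi x0)^-1 *: x0) by rewrite /S/= linearZ/= mulVf.
have ReE x : (complex.Re (`|x| ^+ 2))%:C%C = `|x| ^+ 2.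
  by rewrite RRe_real// ger0_real// exprn_ge0.
pose D := [set complex.Re (`|x| ^+ 2) | x in S].
have D0 : has_inf D.
  split; first by exists (complex.Re (`|(phi x0)^-1 *: x0| ^+ 2)); exists ((phi x0)^-1 *: x0).
  by exists 0 => _ [x _ <-]; rewrite -lecR ReE exprn_ge0.
pose d : R[i] := (inf D)%:C%C.
have dle x : S x -> d <= `|x| ^+ 2.
  by move=> Sx; rewrite -ReE lecR ge_inf//; [case: D0|exists x].
pose Se (e : R[i]) := [set x | S x /\ `|x| ^+ 2 < d + e].
have Se_ne e : 0 < e -> exists x, Se e x.
  move=> e0; have eE : (complex.Re e)%:C%C = e by rewrite RRe_real// gtr0_real.
  have : 0 < complex.Re e by rewrite -ltcR eE.
  move=> /(inf_adherent)/(_ D0)[_ [x Sx <-]] xd; exists x; split => //.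
  by rewrite -ReE -eE /d -rmorphD/= ltcR.
pose F := filter_from [set e : R[i] | 0 < e] Se.
have FF : ProperFilter F.
  apply: filter_from_proper; last by move=> e /Se_ne.
  apply: filter_from_filter; first by exists 1 => /=.
  move=> e f /= e0 f0; have [ef|fe] := real_leP (gtr0_real e0) (gtr0_real f0).
    exists e => // x [Sx xe]; split; split=> //.
    by apply: lt_le_trans xe _; rewrite lerD2l.
  exists f => // x [Sx xf]; split; split=> //.
  by apply: lt_trans xf _; rewrite ltrD2l.
have Fcauchy : cauchy F.
  apply: cauchy_exP => e e0.
  have e40 : 0 < e ^+ 2 / 4 by rewrite divr_gt0 ?exprn_gt0.
  have [x [Sx xe]] := Se_ne _ e40; exists x; exists (e ^+ 2 / 4) => // y [Sy ye].
  rewrite -ball_normE/= -(@ltr_pXn2r _ 2) ?nnegrE ?(ltW e0)//.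
  rewrite hdot_parallelogram.
  have : d <= `|2^-1 *: (x + y)| ^+ 2.
    apply: dle; rewrite /S/= linearZ/= linearD/= Sx Sy.
    by rewrite mulVf// (_ : 1 + 1 = 2%:R)// pnatr_eq0.
  rewrite normrZ exprMn normfV ger0_norm// exprVn ler_pdivlMl ?exprn_gt0// => dxy.
  apply: (@lt_le_trans _ _ (2 * (d + e ^+ 2 / 4) + 2 * (d + e ^+ 2 / 4) - 2 ^+ 2 * d)).
    by rewrite ltr_leD ?lerN2// ltrD// ltr_pM2l.
  by rewrite le_eqVlt; apply/orP; left; apply/eqP; field.
have /cvg_ex[z0 Fz0] := @cauchy_cvg H F FF Fcauchy.
have near_z0 e f : 0 < e -> 0 < f -> exists x, Se e x /\ `|z0 - x| < f.
  move=> e0 f0; have FS : F (Se e) by exists e.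
  have FB : F (ball z0 f) by apply: Fz0; exact: nbhsx_ballx.
  have [x [Sx]] := filter_ex (filterI FS FB).
  by rewrite -ball_normE/= => xf; exists x.
have Sz0 : S z0.
  apply/eqP; rewrite -subr_eq0 -normr_eq0; apply/eqP.
  have M0 : 0 <= M.
    have := le_trans (normr_ge0 _) (phiM x0); rewrite pmulr_lge0// normr_gt0.
    by apply: contra_neq px0 => ->; rewrite linear0.
  apply: (small_eq0 (normr_ge0 _) M0) => e e0.
  have [x [[<- _] xe]] := near_z0 _ _ ltr01 e0.
  by rewrite -linearB (le_trans (phiM _))// mulrC ler_wpM2r// ltW.
have z0_orth k : phi k = 0 -> '[z0, k] = 0.
  move=> pk; have [->|k0] := eqVneq k 0; first by rewrite linear0r.
  apply/eqP; rewrite -normr_eq0; apply/eqP.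
  have K2 : 0 <= 2 * `|k| by rewrite mulr_ge0.
  apply: (small_eq0 (normr_ge0 _) K2) => e e0.
  have [x [[Sx xd] xe]] := near_z0 _ _ (exprn_gt0 2 e0) e0.
  rewrite -[z0](subrK x) linearDl/= (le_trans (ler_normD _ _))//.
  rewrite mulrCA mulr_natl mulr2n lerD//.
    by rewrite (le_trans (hdot_CauchySchwarz _ _))// ler_wpM2r// ltW.
  rewrite -(@ler_pXn2r _ 2) ?nnegrE ?mulr_ge0 ?(ltW e0)// exprMn.
  rewrite -ler_pdivrMr ?exprn_gt0 ?normr_gt0//.
  have : d <= `|x - ('[x, k] / '[k, k]) *: k| ^+ 2.
    by apply: dle; rewrite /S/= linearB/= linearZ/= pk mulr0 subr0.
  rewrite hdot_proj// lerBrDr => /le_lt_trans/(_ xd).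
  by rewrite ltrD2l => /ltW.
have zz0 : '[z0, z0] != 0.
  rewrite dnorm_eq0; apply/eqP => z00; move: Sz0; rewrite z00 /S/= linear0.
  by move/esym/eqP; rewrite oner_eq0.
exists ((('[z0, z0])^-1)^* *: z0) => x.
rewrite linearZr_LR/= conjCK.
have := z0_orth (x - phi x *: z0); rewrite linearB/= linearZ/= Sz0 mulr1 subrr.
move=> /(_ erefl); rewrite linearBr/= linearZr_LR/= => /eqP; rewrite subr_eq0.
move=> /eqP h; rewrite (hdotC x) h rmorphM/= conjCK -(hdotC z0) mulrC mulfK//.
Qed.

End HilbertTheory.

(* The adjoint, total by choice; adjointP shows it is the Hilbert space adjoint
   of every bounded operator. *)
Definition adjoint (R : realType) (H : hilbertType R) (T : H -> H) (y : H) : H :=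
  xget 0 [set z | forall x, '[T x, y] = '[x, z]].

Lemma adjointP (R : realType) (H : hilbertType R) (T : {linear H -> H}) :
  continuous T -> forall x y, '[T x, y] = '[x, adjoint T y].
Proof.
move=> /linear_bounded_continuous/linear_boundedP/pinfty_ex_gt0[M M0 TM] x y.
pose phi x := '[T x, y].
have philin : linear phi.
  by move=> a u v; rewrite /phi linearP linearDl linearZl_LR.
pose phiL : {scalar H} := HB.pack phi (GRing.isLinear.Build _ _ _ _ phi philin).
have phiM u : `|phiL u| <= M * `|y| * `|u|.
  by rewrite (le_trans (hdot_CauchySchwarz _ _))// mulrAC ler_wpM2r.
have [z zP] := Riesz_representation phiM.
by rewrite /adjoint; case: xgetP => [w _ ->//|/(_ z)/(_ zP)].
Qed.

(* Orthogonal complement H (-) A, as a subset of H and as a Hilbert space. *)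
Definition orthoc (R : realType) (H : hilbertType R) (A : set H) : set H :=
  [set x | forall a, A a -> '[x, a] = 0].

Record orthocType (R : realType) (H : hilbertType R) (A : set H) :=
  Orthoc { oval : H; ovalP : oval \in orthoc A }.

Section OrthocType.
Variables (R : realType) (H : hilbertType R) (A : set H).

HB.instance Definition _ := [isSub for @oval R H A].
HB.instance Definition _ := [Choice of orthocType A by <:].

Let orthoc_submod : GRing.subsemimod_closed (fun x : H => x \in orthoc A).
Proof.
split=> [|a x]; first split.
- by apply/mem_set => a _; rewrite linear0l.
- move=> x y /set_mem xA /set_mem yA; apply/mem_set => a Aa.
  by rewrite linearDl/= xA// yA// addr0.
- by move=> /set_mem xA; apply/mem_set => b Ab; rewrite linearZl_LR/= xA// mulr0.
Qed.

HB.instance Definition _ :=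
  GRing.SubChoice_isSubLmodule.Build R[i] H _ (orthocType A) orthoc_submod.

Let onorm (x : orthocType A) : R[i] := `|oval x|.
Let ler_onormD x y : onorm (x + y) <= onorm x + onorm y.
Proof. exact: ler_normD. Qed.
Let onormZ (l : R[i]) x : onorm (l *: x) = `|l| * onorm x.
Proof. exact: normrZ. Qed.
Let onorm_eq0 x : onorm x = 0 -> x = 0.
Proof. by move/normr0_eq0 => x0; exact: val_inj. Qed.

HB.instance Definition _ := @Lmodule_isNormed.Build R[i] (orthocType A)
  onorm ler_onormD onormZ onorm_eq0.

Let orthoc_complete (F : set_system (orthocType A)) :
  ProperFilter F -> cauchy F -> cvg F.
Proof.
move=> FF /cauchyP Fc.
have Gc : cauchy (@oval R H A @ F).
  apply: cauchy_exP => e e0; have [x Fx] := Fc e e0.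
  by exists (oval x); move: Fx; rewrite -!ball_normE.
have /cvgrPdist_lt : cvg (@oval R H A @ F) by exact: cauchy_cvg.
set l := lim _ => Gl.
have lA : l \in orthoc A.
  apply/mem_set => a Aa; apply/eqP; rewrite -normr_eq0; apply/eqP.
  apply: (small_eq0 (normr_ge0 _) (normr_ge0 a)) => e e0.
  have [x xe] := filter_ex (Gl e e0).
  have /set_mem/(_ a Aa) xa := ovalP x.
  rewrite -[l](subrK (oval x)) linearDl/= xa addr0.
  by rewrite (le_trans (hdot_CauchySchwarz _ _))// ler_wpM2r// ltW.
by apply/cvg_ex; exists (Orthoc lA); apply/cvgrPdist_lt.
Qed.

HB.instance Definition _ :=
  Uniform_isComplete.Build (orthocType A) orthoc_complete.

Definition odot (x y : orthocType A) : R[i] := '[oval x, oval y].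

Let odot_linear_l y : linear_for *%R (odot^~ y).
Proof. by move=> a u v; rewrite /odot/= linearDl linearZl_LR. Qed.
Let odot_linear_r x : linear_for (@Num.conj R[i] \; *%R) (odot x).
Proof. by move=> a u v; rewrite /odot/= linearDr linearZr_LR. Qed.
HB.instance Definition _ := bilinear_isBilinear.Build R[i]
  (orthocType A) (orthocType A) R[i] *%R (@Num.conj R[i] \; *%R) odot
  (conj odot_linear_l odot_linear_r).
Let odot_herm x y : odot x y = (-1) ^+ false * (odot y x)^*.
Proof. by rewrite mul1r; exact: hdotC. Qed.
HB.instance Definition _ := isHermitianSesquilinear.Build R[i]
  (orthocType A) false (@Num.conj R[i]) odot odot_herm.
Let odot_gt0 x : x != 0 -> 0 < odot x x.
Proof. by move=> x0; rewrite /odot dnorm_gt0. Qed.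
HB.instance Definition _ := isDotProduct.Build R[i] (orthocType A) odot odot_gt0.
Let odotE (x : orthocType A) : odot x x = `|x| ^+ 2.
Proof. exact: hdotE. Qed.
HB.instance Definition _ :=
  NormedModule_isPreHilbert.Build R (orthocType A) odotE.

End OrthocType.

Definition is_isometry (R : realType) (H : hilbertType R) (V : H -> H) : Prop :=
  forall x, `|V x| = `|x|.

Definition pure_isometry (R : realType) (H : hilbertType R) (V : H -> H) : Prop :=
  is_isometry V /\
  forall x, (fun n : nat => iter n (adjoint V) x) @ \oo --> (0 : H).

Definition pure_commuting_pair (R : realType) (H : hilbertType R)
    (V1 V2 : H -> H) : Prop :=
  [/\ is_isometry V1, is_isometry V2, V1 \o V2 =1 V2 \o V1
    & pure_isometry (V1 \o V2)].

(* Functions on the disc are functions on the subtype of R[i] it coerces to. *)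
Definition unit_disc (R : realType) : set R[i] := [set z | `|z| < 1].
Arguments unit_disc : clear implicits.

Section HardySpace.
Variables (R : realType) (E : hilbertType R).
Implicit Types (f g : unit_disc R -> E) (a b : nat -> E).

Definition has_taylor f a : Prop := forall z : unit_disc R,
  series (fun n => \val z ^+ n *: a n) @ \oo --> f z.

(* H^2_E, with inner product <f, g> = \sum_n <a_n, b_n> on Taylor coefficients. *)
Definition hardy2 : set (unit_disc R -> E) :=
  [set f | exists2 a, has_taylor f a &
     cvg (series (fun n => `|a n| ^+ 2 : R[i]^o) @ \oo)].

Definition hardy2_dot f g (c : R[i]) : Prop := exists a b,
  [/\ has_taylor f a, has_taylor g b
    & series (fun n => '[a n, b n] : R[i]^o) @ \oo --> (c : R[i]^o)].

Definition opnorm_le (T : E -> E) (M : R[i]) : Prop :=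
  forall x, `|T x| <= M * `|x|.

(* Complex differentiability on the disc for the operator norm. *)
Definition op_holomorphic (Theta : unit_disc R -> {linear E -> E}) : Prop :=
  forall z : unit_disc R, exists2 L : {linear E -> E}, continuous L &
    forall e : R[i], 0 < e -> exists2 d : R[i], 0 < d &
      forall w : unit_disc R, w != z -> `|\val w - \val z| < d ->
        opnorm_le
          (fun x => (\val w - \val z)^-1 *: (Theta w x - Theta z x) - L x) e.

Definition hardy_infty (Theta : unit_disc R -> {linear E -> E}) : Prop :=
  (exists M, forall z, opnorm_le (Theta z) M) /\ op_holomorphic Theta.

Definition mult_op (Theta : unit_disc R -> {linear E -> E}) f : unit_disc R -> E :=
  fun z => Theta z (f z).

End HardySpace.

Notation wanderingType V := (orthocType (range V)).

Section BCL.
Variables (R : realType) (H : hilbertType R).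

(* W = H (-) V H *)
Definition wandering (V : H -> H) : set H := orthoc (range V).

(* A unitary of H onto H^2_W that maps V^m eta to z^m eta. *)
Definition wold_unitary (V : H -> H)
    (Pi : {linear H -> (unit_disc R -> wanderingType V)}) : Prop :=
  [/\ range Pi = @hardy2 R (wanderingType V),
      forall x y, hardy2_dot (Pi x) (Pi y) '[x, y]
    & forall m (eta : wanderingType V),
        Pi (iter m V (oval eta)) = fun z => \val z ^+ m *: eta].

Definition BCL_representation (V1 V2 : H -> H)
    (Phi1 Phi2 : unit_disc R ->
       {linear wanderingType (V1 \o V2) -> wanderingType (V1 \o V2)}) : Prop :=
  [/\ hardy_infty Phi1, hardy_infty Phi2
    & exists2 Pi, @wold_unitary (V1 \o V2) Pi &
        forall x, Pi (V1 x) = mult_op Phi1 (Pi x) /\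
                  Pi (V2 x) = mult_op Phi2 (Pi x)].

(* H (-) S is the orthogonal sum of A and B, and T = f|_A (+) g|_B. *)
Definition is_dsum_op (S : set H) (T : orthocType S -> orthocType S)
    (A : set H) (f : H -> H) (B : set H) (g : H -> H) : Prop :=
  [/\ forall a b, A a -> B b -> '[a, b] = 0,
      orthoc S = [set a + b | a in A & b in B]
    & forall w a b, A a -> B b -> oval w = a + b -> oval (T w) = f a + g b].

End BCL.

Arguments wold_unitary {R H} V Pi.
Arguments BCL_representation {R H} V1 V2 Phi1 Phi2.

(* Main.v *)
Require Import Defs.
From HB Require Import structures.
From mathcomp Require Import all_boot all_order all_algebra sesquilinear.
From mathcomp Require Import all_classical all_reals all_analysis.
From mathcomp Require Import complex ring.
Import Order.TTheory GRing.Theory Num.Theory.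
Import numFieldNormedType.Exports.
Local Open Scope classical_set_scope.
Local Open Scope ring_scope.

(** Let [V = V1 V2] and [W = H (-) V H], and let [Pi] be the Wold unitary.
    Vectors of [W] become constant functions under [Pi], so [Phi1 z w] is the
    value at [z] of [Pi (V1 w)]: to compute it one only has to expand [V1 w]
    along [W] and [V W].  For [w = V2 eta1 + eta2], with [eta1] in
    [W1 = H (-) V1 H] and [eta2] in [W2 = H (-) V2 H], that expansion is
    [V1 w = V1 eta2 + V eta1], where both [V1 eta2] and [eta1] lie in [W];
    hence [Phi1 z w = V1 eta2 + z eta1] ([BCL_symbol_val]).

    Every [w] in [W] has this form because [V2 V2^*] is the orthogonal
    projection onto the range of the isometry [V2]: take [eta1 = V2^* w] and
    [eta2 = w - V2 V2^* w] ([wandering_comp_decomp]).  As [V2^* V2 = 1], the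
    coefficient [eta1] of [z] is also [V2^*] applied to the summand [V2 eta1].

    The two symbols play symmetric roles, so everything is proved for a map [V]
    that factors as [A B = B A], and used once for each order of the factors. *)

Lemma isometry_continuous {R : realType} {H : hilbertType R}
    {A : {linear H -> H}} : is_isometry A -> continuous A.
Proof.
move=> isoA; apply/linear_bounded_continuous/linear_boundedP.
exists 1; split; first exact: real1.
move=> M M1 x; rewrite isoA; apply: ler_peMl => //; exact: ltW.
Qed.

(** Polarization: expanding the squared norms of [x + y] and [x + i y] gives
    the sum and the difference of ['[x, y]] and ['[y, x]]. *)
Lemma isometry_hdot {R : realType} {H : hilbertType R} {A : {linear H -> H}} :
  is_isometry A -> forall x y, '[A x, A y] = '[x, y].
Proof.
move=> isoA x y.
have sum_sym u v : '[A u, A v] + '[A v, A u] = '[u, v] + '[v, u].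
  have : '[A (u + v), A (u + v)] = '[u + v, u + v] by rewrite !hdotE isoA.
  rewrite linearD/= !linearDl/= !linearDr/= !hdotE !isoA -!addrA => /addrI.
  by rewrite !addrA => /addIr.
have re := sum_sym x y.
have im := sum_sym x (('i : R[i]) *: y).
move: im; rewrite linearZ/= !linearZr_LR/= !linearZl_LR/= conjCi.
rewrite !mulNr ![- _ + _]addrC -!mulrBr.
move=> /(mulfI (neq0Ci _)) im.
have double (a b : R[i]) : a *+ 2 = (a + b) - (b - a) by ring.
have /eqP : '[A x, A y] *+ 2 = '[x, y] *+ 2; last by rewrite eqrMn2r => /eqP.
by rewrite (double _ '[A y, A x]) (double _ '[y, x]) re im.
Qed.

Lemma adjoint_isometryK {R : realType} {H : hilbertType R}
    {A : {linear H -> H}} : is_isometry A -> cancel A (adjoint A).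
Proof.
move=> isoA a; apply/eqP; rewrite -subr_eq0 -(dnorm_eq0 (@hdot R H)); apply/eqP.
rewrite [LHS]linearBr/= -(adjointP (isometry_continuous isoA)).
by rewrite isometry_hdot// subrr.
Qed.

Lemma wandering_comp_left {R : realType} {H : hilbertType R}
    {A B V : H -> H} : (forall x, V x = A (B x)) ->
  forall x, wandering A x -> wandering V x.
Proof. by move=> VE x Ax _ [y _ <-]; rewrite VE; apply: Ax; exists (B y). Qed.

Lemma wandering_comp_image {R : realType} {H : hilbertType R}
    {A : {linear H -> H}} {B V : H -> H} : is_isometry A ->
  (forall x, V x = A (B x)) ->
  forall x, wandering B x -> wandering V (A x).
Proof.
move=> isoA VE x Bx _ [y _ <-]; rewrite VE isometry_hdot//.
by apply: Bx; exists y.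
Qed.

(** The vectors [adjoint B w] and [w - B (adjoint B w)] realize the
    decomposition, since [B \o adjoint B] projects onto the range of [B]. *)
Lemma wandering_comp_decomp {R : realType} {H : hilbertType R}
    {A B : {linear H -> H}} {V : H -> H} : is_isometry B ->
  (forall x, V x = A (B x)) -> (forall x, V x = B (A x)) ->
  wandering V = [set a + b | a in wandering B & b in B @` wandering A].
Proof.
move=> isoB VAB VBA; have Badj := adjointP (isometry_continuous isoB).
apply/seteqP; split => [w Vw|_ [a Ba [_ [e Ae <-]] <-]].
  exists (w - B (adjoint B w)).
    move=> _ [x _ <-]; rewrite linearBl/= isometry_hdot//.
    by rewrite hdotC Badj -hdotC subrr.
  exists (B (adjoint B w)); last by rewrite subrK.
  exists (adjoint B w) => // _ [x _ <-].
  rewrite hdotC -Badj -hdotC -VBA; apply: Vw; exists x => //.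
move=> v Vv; rewrite linearDl/= (wandering_comp_left VBA _ Ba)//.
by rewrite (wandering_comp_image isoB VBA _ Ae)// addr0.
Qed.

(** The value of a symbol is read off from the first two coefficients of the
    Wold expansion, because [Pi] sends [V^m eta] to [z^m eta]. *)
Lemma symbol_wold_expansion {R : realType} {H : hilbertType R}
    {A : {linear H -> H}} {V : H -> H}
    {Pi : {linear H -> (unit_disc R -> wanderingType V)}}
    {Phi : unit_disc R -> {linear wanderingType V -> wanderingType V}} :
  wold_unitary V Pi -> (forall x, Pi (A x) = mult_op Phi (Pi x)) ->
  forall w u v : wanderingType V, A (oval w) = oval u + V (oval v) ->
  forall z, Phi z w = u + \val z *: v.
Proof.
move=> [_ _ PiE] PiA w u v Aw z.
have Pi0 (x : wanderingType V) : Pi (oval x) z = x.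
  by have := PiE 0%N x; rewrite /= => ->; rewrite expr0 scale1r.
have Pi1 (x : wanderingType V) : Pi (V (oval x)) z = \val z *: x.
  by have := PiE 1%N x; rewrite /= => ->; rewrite expr1.
have := congr1 (@^~ z) (PiA (oval w)); rewrite /mult_op Pi0 => <-.
by rewrite Aw linearD -{2}[u]Pi0 -Pi1.
Qed.

(** Here [A (b + B a) = A b + V a] is already the Wold expansion: [A b] and [a]
    both lie in the wandering subspace of [V]. *)
Lemma BCL_symbol_val {R : realType} {H : hilbertType R}
    {A B : {linear H -> H}} {V : H -> H}
    {Pi : {linear H -> (unit_disc R -> wanderingType V)}}
    {Phi : unit_disc R -> {linear wanderingType V -> wanderingType V}} :
  is_isometry A ->
  (forall x, V x = A (B x)) ->
  wold_unitary V Pi -> (forall x, Pi (A x) = mult_op Phi (Pi x)) ->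
  forall (w : wanderingType V) a b, wandering A a -> wandering B b ->
    oval w = b + B a ->
  forall z, oval (Phi z w) = A b + \val z *: a.
Proof.
move=> isoA VAB Pi_wold PiA w a b Aa Bb wE z.
pose u : wanderingType V := Orthoc (mem_set (wandering_comp_image isoA VAB _ Bb)).
pose v : wanderingType V := Orthoc (mem_set (wandering_comp_left VAB _ Aa)).
have wuv : A (oval w) = oval u + V (oval v) by rewrite wE linearD VAB.
by rewrite (symbol_wold_expansion Pi_wold PiA _ _ _ wuv).
Qed.

Lemma BCL_symbol_dsum {R : realType} {H : hilbertType R}
    {A B : {linear H -> H}} {V : H -> H}
    {Pi : {linear H -> (unit_disc R -> wanderingType V)}}
    {Phi : unit_disc R -> {linear wanderingType V -> wanderingType V}} :
  is_isometry A -> is_isometry B ->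
  (forall x, V x = A (B x)) -> (forall x, V x = B (A x)) ->
  wold_unitary V Pi -> (forall x, Pi (A x) = mult_op Phi (Pi x)) ->
  forall z, is_dsum_op (Phi z) (wandering B) A
    (B @` wandering A) (fun x => \val z *: adjoint B x).
Proof.
move=> isoA isoB VAB VBA Pi_wold PiA z; split.
- by move=> a _ Ba [e _ <-]; apply: Ba; exists e.
- exact: wandering_comp_decomp.
- move=> w b _ Bb [a Aa <-] wE.
  by rewrite adjoint_isometryK// (BCL_symbol_val isoA VAB Pi_wold PiA _ _ _ Aa Bb).
Qed.

Lemma BCL_symbol_exists {R : realType} {H : hilbertType R}
    {A B : {linear H -> H}} {V : H -> H}
    {Pi : {linear H -> (unit_disc R -> wanderingType V)}}
    {Phi : unit_disc R -> {linear wanderingType V -> wanderingType V}} :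
  is_isometry A -> is_isometry B ->
  (forall x, V x = A (B x)) -> (forall x, V x = B (A x)) ->
  wold_unitary V Pi -> (forall x, Pi (A x) = mult_op Phi (Pi x)) ->
  forall a b, wandering A a -> wandering B b -> forall z,
  exists2 w, oval w = b + B a & oval (Phi z w) = A b + \val z *: a.
Proof.
move=> isoA isoB VAB VBA Pi_wold PiA a b Aa Bb z.
have Vw : wandering V (b + B a).
  by rewrite (wandering_comp_decomp isoB VAB VBA); exists b => //; exists (B a).
by exists (Orthoc (mem_set Vw)) => //; apply: (BCL_symbol_val isoA VAB Pi_wold PiA).
Qed.

Theorem theorem3p2 (R : realType) (H : hilbertType R) (V1 V2 : {linear H -> H})
    (Phi1 Phi2 : unit_disc R ->
       {linear wanderingType (V1 \o V2) -> wanderingType (V1 \o V2)}) :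
  pure_commuting_pair V1 V2 ->
  BCL_representation V1 V2 Phi1 Phi2 ->
  forall z : unit_disc R,
    [/\ is_dsum_op (Phi1 z)
          (wandering V2) V1
          (V2 @` wandering V1) (fun x => \val z *: adjoint V2 x),
        is_dsum_op (Phi2 z)
          (wandering V1) V2
          (V1 @` wandering V2) (fun x => \val z *: adjoint V1 x)
      & forall eta1 eta2, wandering V1 eta1 -> wandering V2 eta2 ->
          (exists2 w, oval w = V2 eta1 + eta2 &
             oval (Phi1 z w) = V1 eta2 + \val z *: eta1) /\
          (exists2 w, oval w = eta1 + V1 eta2 &
             oval (Phi2 z w) = V2 eta1 + \val z *: eta2)].
Proof.
move=> [iso1 iso2 V12 _] [_ _ [Pi Pi_wold PiV]] z.
have Pi1 x := (PiV x).1; have Pi2 x := (PiV x).2.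
have VE x : (V1 \o V2) x = V1 (V2 x) by [].
split.
- exact: (BCL_symbol_dsum iso1 iso2 VE V12 Pi_wold Pi1).
- exact: (BCL_symbol_dsum iso2 iso1 V12 VE Pi_wold Pi2).
- move=> eta1 eta2 W1 W2; split; first rewrite [V2 eta1 + _]addrC.
    exact: (BCL_symbol_exists iso1 iso2 VE V12 Pi_wold Pi1).
  exact: (BCL_symbol_exists iso2 iso1 V12 VE Pi_wold Pi2).
Qed.
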